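(* Let $n\geq 2$, let $R\subseteq R_i$ ($i=1,\ldots,n$) be finitely many ring extensions, let $\mathcal R:=\prod_{i=1}^nR_i$, and regard $R\subseteq\mathcal R$ as a ring extension via the diagonal map $r\mapsto(r,\ldots,r)$. Then $R\subseteq\mathcal R$ has FCP if and only if $R$ is an Artinian ring and each extension $R\subseteq R_i$ has FCP.
   Context: All rings are commutative, unital and nonzero; ring morphisms are unital. For a ring extension $R\subseteq S$, $[R,S]$ denotes the set of all $R$-subalgebras of $S$ (i.e. subrings $T$ with $R\subseteq T\subseteq S$). The extension $R\subseteq S$ has FCP if every chain (with respect to inclusion) of elements of $[R,S]$ is finite. *)

(* Defs.v *)
From HB Require Import structures.
From mathcomp Require Import all_boot all_order all_algebra.
From mathcomp Require Import boolp classical_sets functions cardinality.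

Set Implicit Arguments.
Unset Strict Implicit.
Unset Printing Implicit Defensive.

Import GRing.Theory.
Local Open Scope ring_scope.
Local Open Scope classical_set_scope.

(** A ring extension [R ⊆ S] is an injective ring morphism [f : R -> S], with
    [R] identified with its image.  The definitions below take an arbitrary
    morphism; injectivity is a hypothesis of the statements.  They also allow
    the zero ring, because the product over an arbitrary finite index type may
    be zero; see [dffun1_neq0] for nonempty index types. *)

Definition intermediate_rings (R S : comPzRingType) (f : {rmorphism R -> S}) :
    set (set S) :=
  [set T | GRing.subring_closed (mem T) /\ range f `<=` T].

Definition FCP (R S : comPzRingType) (f : {rmorphism R -> S}) : Prop :=
  forall C : set (set S),
    C `<=` intermediate_rings f -> total_on C subset -> finite_set C.

(** [R^o] is [R] as a module over itself; its submodules are the ideals of [R],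
    including [R] (unlike [idealr_closed], which requires proper ideals). *)
Definition is_ideal (R : comPzRingType) (I : set R) : Prop :=
  GRing.submod_closed (mem (I : set R^o)).

Definition artinian (R : comPzRingType) : Prop :=
  forall I : nat -> set R,
    (forall k, is_ideal (I k)) -> (forall k, I k.+1 `<=` I k) ->
    exists N, forall k, (N <= k)%N -> I k = I N.

Section ProductRing.
Variables (J : finType) (A : J -> comPzRingType).

Notation prodA := {dffun forall j : J, A j}.

Definition dffun_zero : prodA := [ffun j : J => (0 : A j)].
Definition dffun_opp (x : prodA) : prodA := [ffun j : J => - x j].
Definition dffun_add (x y : prodA) : prodA := [ffun j : J => x j + y j].
Definition dffun_one : prodA := [ffun j : J => (1 : A j)].
Definition dffun_mul (x y : prodA) : prodA := [ffun j : J => x j * y j].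

Fact dffun_addA : associative dffun_add.
Proof. by move=> x y z; apply/ffunP => j; rewrite !ffunE addrA. Qed.
Fact dffun_addC : commutative dffun_add.
Proof. by move=> x y; apply/ffunP => j; rewrite !ffunE addrC. Qed.
Fact dffun_add0 : left_id dffun_zero dffun_add.
Proof. by move=> x; apply/ffunP => j; rewrite !ffunE add0r. Qed.
Fact dffun_addN : left_inverse dffun_zero dffun_opp dffun_add.
Proof. by move=> x; apply/ffunP => j; rewrite !ffunE addNr. Qed.

HB.instance Definition _ := GRing.isZmodule.Build prodA
  dffun_addA dffun_addC dffun_add0 dffun_addN.

Fact dffun_mulA : associative dffun_mul.
Proof. by move=> x y z; apply/ffunP => j; rewrite !ffunE mulrA. Qed.
Fact dffun_mulC : commutative dffun_mul.
Proof. by move=> x y; apply/ffunP => j; rewrite !ffunE mulrC. Qed.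
Fact dffun_mul1 : left_id dffun_one dffun_mul.
Proof. by move=> x; apply/ffunP => j; rewrite !ffunE mul1r. Qed.
Fact dffun_mulDl : left_distributive dffun_mul dffun_add.
Proof. by move=> x y z; apply/ffunP => j; rewrite !ffunE mulrDl. Qed.

HB.instance Definition _ := GRing.Zmodule_isComPzRing.Build prodA
  dffun_mulA dffun_mulC dffun_mul1 dffun_mulDl.

Variables (R : comPzRingType) (f : forall j : J, {rmorphism R -> A j}).

Definition diag_morph (r : R) : prodA := [ffun j : J => f j r].

Fact diag_morph_is_zmod_morphism : zmod_morphism diag_morph.
Proof. by move=> x y; apply/ffunP => j; rewrite !ffunE rmorphB. Qed.
Fact diag_morph_is_monoid_morphism : monoid_morphism diag_morph.
Proof.
split=> [|x y]; apply/ffunP => j; first by rewrite !ffunE rmorph1.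
by rewrite !ffunE rmorphM.
Qed.

HB.instance Definition _ := GRing.isZmodMorphism.Build R prodA diag_morph
  diag_morph_is_zmod_morphism.
HB.instance Definition _ := GRing.isMonoidMorphism.Build R prodA diag_morph
  diag_morph_is_monoid_morphism.

Lemma diag_morph_inj (j : J) : injective (f j) -> injective diag_morph.
Proof.
by move=> fj_inj x y /ffunP/(_ j); rewrite !ffunE; apply: fj_inj.
Qed.

End ProductRing.

Lemma dffun1_neq0 (J : finType) (A : J -> comNzRingType) (j : J) :
  (1 : {dffun forall j : J, A j}) != 0.
Proof. by apply/eqP => /ffunP/(_ j)/eqP; rewrite !ffunE oner_eq0. Qed.

(* Main.v *)
Require Import Defs.
From mathcomp Require Import all_boot all_order all_algebra.
From mathcomp Require Import boolp classical_sets functions cardinality.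

Set Implicit Arguments.
Unset Strict Implicit.
Unset Printing Implicit Defensive.

Import GRing.Theory.
Local Open Scope ring_scope.
Local Open Scope classical_set_scope.

(** If the product has FCP, then so does each factor, because the inverse image
    of a subring of a factor is a subring of the product.  Moreover [R] is
    Artinian: an ideal [I] is recovered from the subring of those tuples that
    are diagonal modulo [I], with an entry of the diagonal singled out, so a
    chain of ideals gives a chain of intermediate rings.  Two factors are
    needed here to see the difference of two entries.

    Conversely, let [R] be Artinian and [R ⊆ S] have FCP.  The point is that [S]
    has finite length as an [R]-module ([finite_length]).  Finite length passes
    to finite products, and intermediate rings are submodules, so FCP of the
    product follows.

    Let [P] be a maximal ideal of [R].  A subring [T ⊇ R] of [S] that is maximal
    among those with [T/PS] of finite length must be [S]: for [x] outside [T],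
    the descending chain of the rings [R[x^(2^k)]] stabilizes, which gives an
    algebraic relation for [x] with a coefficient equal to 1.  That relation can
    be made monic modulo [P], so [T[x]] is a finite sum of the [T x^i], and
    [T[x]/PS] has finite length too.  Hence [S/PS] has finite length
    ([chain_finite_residue]).

    It remains to go from [S/PS] to [S].  An Artinian ring admits induction
    down from [R] to [0] along ideals, each step going from [I + Ry] to [I] with
    [Py ⊆ I] for a maximal ideal [P] ([artinian_ind]).  In such a step
    [(I + Ry)S / IS] is the image of [S/PS] under multiplication by [y], so the
    finite length of [S/IS] is inherited all the way to [I = 0].

    Finite length of a subquotient [B/A] is expressed without quotients, as the
    finiteness of all chains of submodules between [A] and [B]; lengths are
    never counted. *)

(** * Families of sets whose chains are finite *)

Definition chain_finite (X : Type) (P : set (set X)) : Prop :=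
  forall C : set (set X), C `<=` P -> total_on C subset -> finite_set C.

(** The main tool to move finiteness of chains from one family to another.  Two
    maps are allowed so that extensions of modules are covered: a submodule is
    determined, among those comparable to it, by its intersection with a fixed
    submodule and its image modulo that submodule.  On a chain, injectivity has
    to be checked on comparable members only. *)
Lemma chain_finite_embed (X Y Z : Type) (P : set (set X)) (Q1 : set (set Y))
    (Q2 : set (set Z)) (phi1 : set X -> set Y) (phi2 : set X -> set Z) :
  (forall N, P N -> Q1 (phi1 N)) -> (forall N, P N -> Q2 (phi2 N)) ->
  (forall N N', N `<=` N' -> phi1 N `<=` phi1 N') ->
  (forall N N', N `<=` N' -> phi2 N `<=` phi2 N') ->
  (forall N N', P N -> P N' -> N `<=` N' ->
     phi1 N' `<=` phi1 N -> phi2 N' `<=` phi2 N -> N' `<=` N) ->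
  chain_finite Q1 -> chain_finite Q2 -> chain_finite P.
Proof.
move=> PQ1 PQ2 mono1 mono2 inj Q1fin Q2fin C CP Ctot.
have fin1 : finite_set (phi1 @` C).
  apply: Q1fin => [_ [N CN <-]|_ _ [N CN <-] [N' CN' <-]].
    exact/PQ1/CP.
  by case: (Ctot _ _ CN CN') => /mono1; [left|right].
have fin2 : finite_set (phi2 @` C).
  apply: Q2fin => [_ [N CN <-]|_ _ [N CN <-] [N' CN' <-]].
    exact/PQ2/CP.
  by case: (Ctot _ _ CN CN') => /mono2; [left|right].
have phi_inj : set_inj C (fun N => (phi1 N, phi2 N)).
  move=> N N' /set_mem CN /set_mem CN' [eq1 eq2].
  have [NN'|N'N] := Ctot _ _ CN CN'; apply/seteqP; split=> //.
    by apply: inj => //; [exact: CP|exact: CP|rewrite eq1|rewrite eq2].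
  by apply: inj => //; [exact: CP|exact: CP|rewrite eq1|rewrite eq2].
rewrite -(eq_finite_set (inj_card_eq phi_inj)).
apply: sub_finite_set (finite_setX fin1 fin2) => _ [N CN <-].
by split; exists N.
Qed.

Lemma chain_finite_embed1 (X Y : Type) (P : set (set X)) (Q : set (set Y))
    (phi : set X -> set Y) :
  (forall N, P N -> Q (phi N)) ->
  (forall N N', N `<=` N' -> phi N `<=` phi N') ->
  (forall N N', P N -> P N' -> N `<=` N' -> phi N' `<=` phi N -> N' `<=` N) ->
  chain_finite Q -> chain_finite P.
Proof.
move=> PQ mono inj Qfin.
apply: (chain_finite_embed PQ PQ mono mono) => // N N' PN PN' NN' sub _.
exact: inj NN' sub.
Qed.

Lemma chain_finite_sub (X : Type) (P Q : set (set X)) :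
  P `<=` Q -> chain_finite Q -> chain_finite P.
Proof. by move=> PQ Qfin C CP; apply: Qfin => N /CP/PQ. Qed.

(** Common source of the two chain conditions below: a finite range has been
    exhausted by some time [N]. *)
Lemma chain_finite_range (X : Type) (P : set (set X)) (u : nat -> set X) :
  chain_finite P -> (forall k, P (u k)) -> total_on (range u) subset ->
  exists N, forall k, exists2 i, (i <= N)%N & u k = u i.
Proof.
move=> Pfin Pu utot.
have /finite_seqP[s rs] : finite_set (range u).
  by apply: Pfin => // _ [k _ <-].
have /choice[g gP] : forall y, exists i, range u y -> u i = y.
  by move=> y; have [[i _ <-]|ny] := pselect (range u y); [exists i|exists 0%N].
exists (\max_(y <- s) g y) => k; exists (g (u k)); last by rewrite gP.
have uks : u k \in s by have : range u (u k) by []; rewrite rs.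
by rewrite (big_rem _ uks) /= leq_maxl.
Qed.

Lemma decr_seq_sub (X : Type) (u : nat -> set X) :
  (forall k, u k.+1 `<=` u k) -> forall i j, (i <= j)%N -> u j `<=` u i.
Proof.
move=> udec i j /subnKC <-; elim: (j - i)%N => [|k IH]; first by rewrite addn0.
by rewrite addnS; apply: subset_trans IH.
Qed.

Lemma chain_finite_dcc (X : Type) (P : set (set X)) (u : nat -> set X) :
  chain_finite P -> (forall k, P (u k)) -> (forall k, u k.+1 `<=` u k) ->
  exists N, forall k, (N <= k)%N -> u k = u N.
Proof.
move=> Pfin Pu udec; have usub := decr_seq_sub udec.
have [|N NP] := chain_finite_range Pfin Pu.
  move=> _ _ [i _ <-] [j _ <-].
  by have [ij|/ltnW ji] := leqP i j; [right|left]; apply: usub.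
exists N => k Nk; apply/seteqP; split; first exact: usub.
by have [i iN ->] := NP k; apply: usub.
Qed.

Lemma chain_finite_acc (X : Type) (P : set (set X)) (u : nat -> set X) :
  chain_finite P -> (forall k, P (u k)) -> (forall k, u k `<=` u k.+1) ->
  exists k, u k.+1 `<=` u k.
Proof.
move=> Pfin Pu uinc.
have usub i j : (i <= j)%N -> u i `<=` u j.
  move=> ij; rewrite -[u i]setCK -[u j]setCK; apply: subsetC.
  by apply: (@decr_seq_sub _ (fun k => ~` u k)) ij => k; apply: subsetC.
have [|N NP] := chain_finite_range Pfin Pu.
  move=> _ _ [i _ <-] [j _ <-].
  by have [ij|/ltnW ji] := leqP i j; [left|right]; apply: usub.
by exists N; have [i iN ->] := NP N.+1; apply: usub.
Qed.

(** Well-foundedness in its sequential form, turned into its minimal element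
    form by dependent choice. *)
Lemma minimal_element (T : Type) (P : set T) (lt : T -> T -> Prop) :
  (forall u : nat -> T, (forall k, P (u k)) ->
     ~ (forall k, lt (u k.+1) (u k))) ->
  (exists x, P x) -> exists2 x, P x & forall y, P y -> ~ lt y x.
Proof.
move=> wf [x0 Px0]; apply: contrapT => nomin.
have step (x : {x | P x}) : {y : {y | P y} | lt (sval y) (sval x)}.
  apply: cid; case: x => x Px /=; apply: contrapT => nolt; apply: nomin.
  by exists x => // y Py ltyx; apply: nolt; exists (exist _ y Py).
have [u [_ uP]] := dependent_choice step (exist _ x0 Px0).
by apply: (wf (fun k => sval (u k))) => // k; apply: svalP.
Qed.

(** * Submodules of a ring extension *)

Section Submodules.
Variables (R S : comPzRingType) (f : {rmorphism R -> S}).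

Definition submodule : set (set S) :=
  [set N | [/\ N 0, forall x y, N x -> N y -> N (x + y)
             & forall r x, N x -> N (f r * x)]].

Definition submods (A B : set S) : set (set S) :=
  [set N | [/\ submodule N, A `<=` N & N `<=` B]].

(** The submodule [J·B] generated by products, as an intersection, so that
    membership is an induction principle. *)
Definition prodspan (J : set R) (B : set S) : set S :=
  [set y | forall N, submodule N ->
     (forall a s, J a -> B s -> N (f a * s)) -> N y].

(** [A + zB], the common form of [I + Ry] for ideals, of the adjunction of [x] to
    a subring, and of the ordinary sum of submodules ([z = 1]). *)
Definition shift_sum (A : set S) (z : S) (B : set S) : set S :=
  [set x | exists a b, [/\ A a, B b & x = a + z * b]].

Lemma submoduleN N x : submodule N -> N x -> N (- x).
Proof. by move=> [_ _ NZ] /(NZ (-1)); rewrite rmorphN1 mulN1r. Qed.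

Lemma submoduleB N x y : submodule N -> N x -> N y -> N (x - y).
Proof.
by move=> Nsub Nx Ny; case: (Nsub) => _ ND _; apply: ND (submoduleN _ _).
Qed.

Lemma submoduleT : submodule setT. Proof. by []. Qed.

Lemma submodule_prodspan J B : submodule (prodspan J B).
Proof.
split=> [N [] //|x y Jx Jy N Nsub NJ|r x Jx N Nsub NJ].
  by case: (Nsub) => _ ND _; apply: ND; [apply: Jx|apply: Jy].
by case: (Nsub) => _ _; apply; apply: Jx.
Qed.

Lemma prodspan_gen (J : set R) (B : set S) a s :
  J a -> B s -> prodspan J B (f a * s).
Proof. by move=> Ja Bs N _; apply. Qed.

Lemma submodule_preim N z : submodule N -> submodule [set t | N (z * t)].
Proof.
move=> [N0 ND NZ]; split=> /= [|x y Nx Ny|r x Nx].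
- by rewrite mulr0.
- by rewrite mulrDr; apply: ND.
- by rewrite mulrCA; apply: NZ.
Qed.

Lemma prodspan_mul J z y : prodspan J setT y -> prodspan J setT (z * y).
Proof.
have JSz := submodule_preim z (submodule_prodspan J setT).
move=> Jy; apply: (Jy _ JSz) => a s Ja _ /=.
by rewrite mulrCA; apply: prodspan_gen.
Qed.

Lemma submodule_shift_sum A z B :
  submodule A -> submodule B -> submodule (shift_sum A z B).
Proof.
move=> [A0 AD AZ] [B0 BD BZ]; split.
- by exists 0, 0; rewrite mulr0 addr0.
- move=> _ _ [a [b [Aa Bb ->]]] [a' [b' [Aa' Bb' ->]]].
  exists (a + a'), (b + b'); split; [exact: AD|exact: BD|].
  by rewrite mulrDr addrACA.
- move=> r _ [a [b [Aa Bb ->]]]; exists (f r * a), (f r * b).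
  by split; [exact: AZ|exact: BZ|rewrite mulrDr (mulrCA z)].
Qed.

Lemma sub_shift_sum (A : set S) z B : submodule B -> A `<=` shift_sum A z B.
Proof. by move=> [B0 _ _] a Aa; exists a, 0; rewrite mulr0 addr0. Qed.

(** Finite length is closed under extensions: by the modular law, comparable
    submodules with the same intersection with [B] and the same sum with [B]
    are equal. *)
Lemma chain_finite_trans A B C : submodule B -> submodule C ->
  A `<=` B -> B `<=` C ->
  chain_finite (submods A B) -> chain_finite (submods B C) ->
  chain_finite (submods A C).
Proof.
move=> Bsub Csub AB BC.
apply: (chain_finite_embed (phi1 := setI B) (phi2 := shift_sum B 1)).
- move=> N [[N0 ND NZ] AN NC]; case: (Bsub) => B0 BD BZ; split.
  + by split=> // [x y [? ?] [? ?]|r x [? ?]]; split; auto.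
  + by move=> x Ax; split; [exact: AB|exact: AN].
  + by move=> x [].
- move=> N [Nsub AN NC]; split; first exact: submodule_shift_sum.
    exact: sub_shift_sum.
  move=> _ [b [n [Bb Nn ->]]]; rewrite mul1r; case: (Csub) => _ CD _.
  by apply: CD; [exact: BC|exact: NC].
- by move=> N N' NN' x [Bx Nx]; split=> //; apply: NN'.
- by move=> N N' NN' _ [b [n [? ? ->]]]; exists b, n; split=> //; apply: NN'.
- move=> N N' [Nsub _ _] [N'sub _ _] NN' capNN' sumNN' x N'x.
  have [|b [n [Bb Nn xE]]] := sumNN' x.
    by exists 0, x; rewrite mul1r add0r; case: Bsub.
  case: (Nsub) => _ ND _; rewrite xE mul1r; apply: (ND) => //.
  suff [] : (B `&` N) b by [].
  apply: capNN'; split=> //; have -> : b = x - n by rewrite xE mul1r addrK.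
  by apply: submoduleB => //; apply: NN'.
Qed.

(** Multiplication by [z] maps [B/A] onto [(A' + zB)/A'], and a quotient of a
    module of finite length has finite length. *)
Lemma chain_finite_shift A B A' z : submodule A' -> submodule B ->
  A `<=` B -> (forall a, A a -> A' (z * a)) ->
  chain_finite (submods A B) -> chain_finite (submods A' (shift_sum A' z B)).
Proof.
move=> A'sub Bsub AB zAA'.
apply: (chain_finite_embed1 (phi := fun N => B `&` [set t | N (z * t)])).
- move=> N [Nsub AN NC]; split; last by move=> x [].
    have [N0 ND NZ] := submodule_preim z Nsub; case: (Bsub) => B0 BD BZ.
    by split=> // [x y [? ?] [? ?]|r x [? ?]]; split; auto.
  by move=> a Aa; split; [exact: AB|exact/AN/zAA'].
- by move=> N N' NN' x [Bx Nx]; split=> //; apply: NN'.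
- move=> N N' [Nsub AN _] [N'sub AN' N'C] NN' preNN' x N'x.
  have [a [b [Aa Bb xE]]] := N'C x N'x.
  case: (Nsub) => _ ND _; rewrite xE; apply: ND; first exact: AN.
  suff [] : (B `&` [set t | N (z * t)]) b by [].
  apply: preNN'; split=> //=; have -> : z * b = x - a by rewrite xE addrC addKr.
  by apply: submoduleB => //; apply: AN'.
Qed.

End Submodules.

Lemma is_idealE (R : comPzRingType) (I : set R) :
  is_ideal I <-> submodule (idfun : {rmorphism R -> R}) I.
Proof.
rewrite /is_ideal; split=> [[]|Isub].
  rewrite in_setE => I0 Ilin.
  have Ilin' (r x y : R) : I x -> I y -> I (r * x + y).
    by have := Ilin r x y; rewrite !in_setE.
  split=> // [x y Ix Iy|r x Ix] /=.
    by have := Ilin' 1 _ _ Ix Iy; rewrite mul1r.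
  by have := Ilin' r _ _ Ix I0; rewrite addr0.
case: (Isub) => I0 ID IZ; split; first by rewrite in_setE.
move=> r x y; rewrite !in_setE => Ix Iy; apply: ID => //; exact: IZ.
Qed.

Lemma intermediate_ringsE (R S : comPzRingType) (f : {rmorphism R -> S}) T :
  intermediate_rings f T <->
  [/\ forall x y, T x -> T y -> T (x - y), forall x y, T x -> T y -> T (x * y)
    & forall r, T (f r)].
Proof.
rewrite /intermediate_rings /=; split=> [[[T1 TB TM] Tf]|[TB TM Tf]].
  split=> [x y|x y|r]; last by apply: Tf; exists r.
    by have := TB x y; rewrite !in_setE.
  by have := TM x y; rewrite !in_setE.
split; last by move=> _ [r _ <-].
split=> [|x y|x y]; rewrite !in_setE; [|by apply: TB|by apply: TM].
by rewrite -(rmorph1 f).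
Qed.

Lemma intermediate_submodule (R S : comPzRingType) (f : {rmorphism R -> S}) T :
  intermediate_rings f T -> submodule f T.
Proof.
move=> /intermediate_ringsE[TB TM Tf].
have T0 : T 0 by rewrite -(rmorph0 f).
split=> // [x y Tx Ty|r x Tx]; last by apply: TM.
by rewrite -[y]opprK; apply: (TB) => //; rewrite -sub0r; apply: TB.
Qed.

(** * Artinian rings *)

Section Artinian.
Variable R : comPzRingType.

Notation ideal := (submodule (idfun : {rmorphism R -> R})).

(** Maximality is stated through the residue ring being a field. *)
Definition maximal_ideal (P : set R) : Prop :=
  [/\ ideal P, ~ P 1 & forall a, ~ P a -> exists b, P (1 - b * a)].

Lemma artinian_minimal (Q : set (set R)) : artinian R ->
  (exists2 J, ideal J & Q J) ->
  exists J, [/\ ideal J, Q J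
            & forall I, ideal I -> Q I -> I `<=` J -> J `<=` I].
Proof.
move=> Rart [J0 J0id QJ0].
have [||J [Jid QJ] Jmin] := @minimal_element _ [set J | ideal J /\ Q J]
  (fun I J => I `<=` J /\ ~ J `<=` I).
- move=> u uP ult; have [k|k|N uN] := Rart u.
  + by apply/is_idealE; case: (uP k).
  + by case: (ult k).
  + by case: (ult N) => _; apply; rewrite uN.
- by exists J0.
exists J; split=> // I Iid QI IJ; apply: contrapT => nJI.
by apply: (Jmin I).
Qed.

(** Take an ideal [K] minimal with [KJ <> 0].  It is generated by any of its
    elements [x] with [xJ <> 0], and the same holds for each multiple [ax] with
    [axJ <> 0]; so [x] is a multiple of [ax], which makes the annihilator [P] of
    [xJ] a maximal ideal.  If [J] were equal to [PJ], then [xJ = xPJ = 0]. *)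
Lemma nonzero_ideal_max (J : set R) : artinian R -> ideal J ->
  (exists2 j, J j & j <> 0) ->
  exists2 P, maximal_ideal P &
    ~ J `<=` prodspan (idfun : {rmorphism R -> R}) P J.
Proof.
move=> Rart Jid [j0 Jj0 nzj0].
have [|K [Kid [x [j [Kx Jj nzxj]]] Kmin]] :=
  @artinian_minimal (fun K => exists x j, [/\ K x, J j & x * j <> 0]) Rart.
  by exists setT => //; exists 1, j0; rewrite mul1r.
pose P := [set a | forall i, J i -> a * x * i = 0].
exists P.
  split=> [|P1|a nPa].
  - split=> [i _|a b Pa Pb i Ji|r a Pa i Ji]; rewrite /P /=.
    + by rewrite !mul0r.
    + by rewrite !mulrDl Pa // Pb // addr0.
    + by rewrite -!mulrA (mulrA a) Pa // mulr0.
  - by apply: nzxj; rewrite -[x]mul1r; apply: P1.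
  - have [i [Ji nzi]] : exists i, J i /\ a * x * i <> 0.
      apply: contrapT => nex; apply: nPa => i Ji; apply: contrapT => nz.
      by apply: nex; exists i.
    have [|||b _ bE] := Kmin [set b * (a * x) | b in setT] _ _ _ x Kx.
    + split=> [|_ _ [b _ <-] [c _ <-]|r _ [b _ <-]] /=.
      * by exists 0; rewrite ?mul0r.
      * by exists (b + c); rewrite ?mulrDl.
      * by exists (r * b); rewrite ?mulrA.
    + by exists (a * x), i; split=> //; exists 1; rewrite ?mul1r.
    + by move=> _ [b _ <-]; case: Kid => _ _ KZ; apply: (KZ b); apply: (KZ a).
    + exists b => k Jk; rewrite mulrBl mul1r -mulrA bE subrr mul0r //.
move=> JPJ; apply: nzxj.
apply: (JPJ _ Jj [set i | x * i = 0]).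
  split=> [|y z xy xz|r y xy] /=; first by rewrite mulr0.
    by rewrite mulrDr xy xz addr0.
  by rewrite mulrCA xy mulr0.
by move=> a s Pa Js /=; rewrite mulrA (mulrC x); apply: Pa.
Qed.

(** [J/PJ] is a nonzero vector space over the residue field of [P], so it has a
    hyperplane, of which [I] is the inverse image.  It comes from Zorn's lemma,
    as a subspace maximal among those that avoid a given nonzero vector. *)
Lemma simple_quotient (J P : set R) : ideal J -> maximal_ideal P ->
  ~ J `<=` prodspan (idfun : {rmorphism R -> R}) P J ->
  exists I y, [/\ ideal I, J = shift_sum I y setT, ~ I y
                & forall p, P p -> I (p * y)].
Proof.
set PJ := prodspan _ P J => Jid [Pid P1 Pmax] nJPJ.
have [y Jy nPJy] : exists2 y, J y & ~ PJ y.
  apply: contrapT => nex; apply: nJPJ => y Jy; apply: contrapT => nPJy.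
  by apply: nex; exists y.
have PJid : ideal PJ by apply: submodule_prodspan.
have PJJ : PJ `<=` J.
  by move=> z; apply=> // a s _ Js; case: Jid => _ _; apply.
(* The empty chain has the union set0, which is not an ideal; so set0 is
   admitted, and then discarded because PJ is larger. *)
pose good I := [/\ ideal I, PJ `<=` I, I `<=` J & ~ I y].
have [F Fgood Ftot|I [Igood Imax]] :=
  @Zorn_bigcup _ (fun I => I = set0 \/ good I).
  have [[X [FX Xgood]]|nogood] := pselect (exists X, F X /\ good X); last first.
    left; apply/seteqP; split=> // z [X FX Xz]; have [X0|Xgood] := Fgood X FX.
      by rewrite X0 in Xz.
    by apply: nogood; exists X.
  have Fid Y z : F Y -> Y z -> good Y.
    by move=> FY Yz; have [Y0|//] := Fgood Y FY; rewrite Y0 in Yz.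
  right; split.
  - split=> [|a b [Y FY Ya] [Z FZ Zb]|r a [Y FY Ya]].
    + by exists X => //; case: Xgood => -[].
    + have [[_ YD _] _ _ _] := Fid _ _ FY Ya.
      have [[_ ZD _] _ _ _] := Fid _ _ FZ Zb.
      have [YZ|ZY] := Ftot _ _ FY FZ.
        by exists Z => //; apply: ZD => //; apply: YZ.
      by exists Y => //; apply: YD => //; apply: ZY.
    + by exists Y => //; have [[_ _ YZ] _ _ _] := Fid _ _ FY Ya; apply: YZ.
  - by move=> z PJz; exists X => //; case: Xgood => _ + _ _; apply.
  - by move=> z [Y FY Yz]; have [_ _ YJ _] := Fid _ _ FY Yz; apply: YJ.
  - by move=> [Y FY Yy]; have [_ _ _ nYy] := Fid _ _ FY Yy.
have {Igood} [Iid PJI IJ nIy] : good I.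
  case: Igood => // I0; case: (Imax PJ); last by right; split.
  by rewrite I0; split=> // /(_ 0); apply; case: PJid.
have [I0 ID IZ] := Iid; have [J0 JD JZ] := Jid.
have PyI p : P p -> I (p * y) by move=> Pp; apply: PJI; apply: prodspan_gen.
exists I, y; split=> //.
apply/seteqP; split=> [z Jz|_ [a [b [Ia _ ->]]]]; last first.
  by apply: JD; [exact: IJ|rewrite mulrC; apply: (JZ b)].
have [Iz|nIz] := pselect (I z).
  by exists z, 0; rewrite mulr0 addr0.
have [i [r [Ii _ yE]]] : shift_sum I z setT y.
  apply: contrapT => nIzy; apply: (Imax (shift_sum I z setT)).
    split; first by apply: (@sub_shift_sum _ _ idfun).
    by move=> /(_ z) sub; apply/nIz/sub; exists 0, 1; rewrite mulr1 add0r.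
  right; split=> //; first by apply: submodule_shift_sum.
    by move=> t PJt; apply: (@sub_shift_sum _ _ idfun) => //; apply: PJI.
  move=> _ [a [b [Ia _ ->]]].
  by apply: JD; [exact: IJ|rewrite mulrC; apply: (JZ b)].
have nPr : ~ P r.
  move=> Pr; apply: nIy; rewrite yE; apply: ID => //; rewrite mulrC.
  by apply: PJI; apply: prodspan_gen.
have [b Pb] := Pmax r nPr.
exists ((1 - b * r) * z - b * i), b; split=> //.
  apply: (submoduleB Iid); last exact: (IZ b).
  by apply: PJI; apply: prodspan_gen.
rewrite yE (mulrDl i) (mulrC i) addrA subrK mulrBl mul1r (mulrC _ b).
by rewrite (mulrC z) mulrA subrK.
Qed.

(** A minimal ideal with the property [Q] is zero, as otherwise it could be
    shrunk by a hyperplane step.  This replaces both the nilpotence of the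
    radical and the composition series of an Artinian ring. *)
Lemma artinian_ind (Q : set (set R)) : artinian R -> Q setT ->
  (forall P I y, maximal_ideal P -> ideal I -> (forall p, P p -> I (p * y)) ->
     Q (shift_sum I y setT) -> Q I) ->
  Q [set 0].
Proof.
move=> Rart QT Qstep.
have [|J [Jid QJ Jmin]] := artinian_minimal Rart (Q := Q); first by exists setT.
suff <- : J = [set 0] by [].
apply/seteqP; split=> [j Jj|_ ->]; last by case: Jid.
apply: contrapT => nzj.
have [|P Pmax nJPJ] := nonzero_ideal_max Rart Jid; first by exists j.
have [I [y [Iid JE nIy PyI]]] := simple_quotient Jid Pmax nJPJ.
apply/nIy/(Jmin I) => //.
- by apply: (Qstep P I y) => //; rewrite -JE.
- by rewrite JE; apply: (@sub_shift_sum _ _ idfun).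
- by rewrite JE; exists 0, 1; rewrite mulr1 add0r; case: Iid.
Qed.

End Artinian.

(** * Extensions with FCP modulo a maximal ideal *)

Section Residue.
Variables (R S : comNzRingType) (f : {rmorphism R -> S}).

(** The rings [R[x^(2^k)]] decrease, so [x^M] is a polynomial in [x^(2M)] for
    some [M = 2^N].  The exponent [M] is not a multiple of [2M], so [x^M] does not
    cancel in the resulting relation. *)
Lemma FCP_relation (x : S) : FCP f ->
  exists (p : {poly R}) M, (map_poly f p).[x] = 0 /\ p`_M = 1.
Proof.
move=> fcp; pose u k := [set (map_poly f p).[x ^+ (2 ^ k)] | p in setT].
have uring k : intermediate_rings f (u k).
  apply/intermediate_ringsE; split.
  - move=> _ _ [p _ <-] [q _ <-]; exists (p - q) => //.
    by rewrite rmorphB !hornerE.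
  - move=> _ _ [p _ <-] [q _ <-]; exists (p * q) => //.
    by rewrite rmorphM !hornerE.
  - by move=> r; exists r%:P; rewrite // map_polyC hornerC.
have udec k : u k.+1 `<=` u k.
  move=> _ [p _ <-]; exists (p \Po 'X^2) => //.
  by rewrite map_comp_poly map_polyXn horner_comp hornerXn -exprM expnSr.
have [N uN] := chain_finite_dcc fcp uring udec.
have : u N (x ^+ (2 ^ N)) by exists 'X => //; rewrite map_polyX hornerX.
rewrite -(uN N.+1) // => -[p _ pE].
exists ('X^(2 ^ N) - (p \Po 'X^(2 ^ N.+1))), (2 ^ N)%N; split.
  rewrite rmorphB /= map_comp_poly !map_polyXn hornerD hornerN horner_comp.
  by rewrite !hornerXn pE subrr.
rewrite coefB coefXn eqxx coef_comp_poly_Xn ?expn_gt0 // gtnNdvd ?subr0 //.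
  by rewrite expn_gt0.
by rewrite ltn_exp2l.
Qed.

Variable P : set R.
Hypothesis Pmax : maximal_ideal P.

Notation PS := (prodspan f P setT).

(** Modulo [PS], the terms of a relation with coefficient in [P] vanish, and the
    highest remaining coefficient is invertible modulo [P]. *)
Lemma integral_mod_max (x : S) n (c : nat -> R) :
  PS (\sum_(i < n) f (c i) * x ^+ i) -> (exists2 i, (i < n)%N & ~ P (c i)) ->
  exists d (b : nat -> R), PS (x ^+ d - \sum_(i < d) f (b i) * x ^+ i).
Proof.
have [_ _ Pinv] := Pmax; have PSsub := submodule_prodspan f P setT.
elim: n => [|n IH]; first by move=> _ [].
rewrite big_ord_recr /= => PSsum [i iltn nPi].
have [Pcn|nPcn] := pselect (P (c n)).
  apply: IH.
    rewrite -[X in PS X](addrK (f (c n) * x ^+ n)).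
    by apply: (submoduleB PSsub) => //; apply: prodspan_gen.
  exists i => //; move: iltn; rewrite ltnS leq_eqVlt => /predU1P[iE|//].
  by rewrite iE in nPi.
have [b Pb] := Pinv _ nPcn; exists n, (fun i => - (b * c i)).
have -> : \sum_(i < n) f (- (b * c i)) * x ^+ i
        = - (f b * \sum_(i < n) f (c i) * x ^+ i).
  rewrite mulr_sumr -sumrN; apply: eq_bigr => j _.
  by rewrite rmorphN rmorphM mulNr mulrA.
rewrite opprK.
have -> : x ^+ n + f b * (\sum_(i < n) f (c i) * x ^+ i)
  = f (1 - b * c n) * x ^+ n
    + f b * (\sum_(i < n) f (c i) * x ^+ i + f (c n) * x ^+ n).
  rewrite rmorphB rmorph1 rmorphM mulrBl mul1r mulrDr !mulrA addrA addrAC.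
  by rewrite subrK.
case: (PSsub) => _ PSD PSZ; apply: PSD; last exact: PSZ.
exact: prodspan_gen.
Qed.

(** When [x^d] lies in this module, it is the ring [T[x]]; see
    [poly_ext_ring]. *)
Definition poly_ext (T : set S) (x : S) (d : nat) : set S :=
  [set y | exists t : nat -> S,
     (forall i, T (t i)) /\ y = \sum_(i < d) t i * x ^+ i].

(** Horner's rule.  It expresses the module through [T] and its own multiple by
    [x], so that [chain_finite_shift] applies. *)
Lemma poly_extS T x d : poly_ext T x d.+1 = shift_sum T x (poly_ext T x d).
Proof.
apply/seteqP; split=> [_ [t [Tt ->]]|_ [a [_ [Ta [t [Tt ->]] ->]]]].
  exists (t 0%N), (\sum_(i < d) t i.+1 * x ^+ i); split=> //.
    by exists (fun i => t i.+1).
  rewrite big_ord_recl mulr1 mulr_sumr; congr (_ + _).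
  by apply: eq_bigr => i _; rewrite exprS mulrCA.
exists (fun i => if i is i'.+1 then t i' else a); split; first by case.
rewrite big_ord_recl mulr1 mulr_sumr; congr (_ + _).
by apply: eq_bigr => i _; rewrite exprS mulrCA.
Qed.

Lemma submodule_poly_ext T x d : submodule f T -> submodule f (poly_ext T x d).
Proof.
move=> Tsub; elim: d => [|d IH]; last first.
  by rewrite poly_extS; apply: submodule_shift_sum.
have -> : poly_ext T x 0 = [set 0].
  apply/seteqP; split=> [_ [t [_ ->]]|_ ->]; first by rewrite big_ord0.
  by exists (fun=> 0); rewrite big_ord0; split=> // _; case: Tsub.
by split=> [|_ _ -> ->|r _ ->] //=; rewrite ?addr0 ?mulr0.
Qed.

Lemma poly_ext_ring T x d : intermediate_rings f T ->
  poly_ext T x d.+1 (x ^+ d.+1) -> intermediate_rings f (poly_ext T x d.+1).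
Proof.
move=> Tring xd; have Tsub := intermediate_submodule Tring.
move/intermediate_ringsE: Tring => [TB TM Tf].
have Vsub := submodule_poly_ext x d.+1 Tsub.
have TV : T `<=` poly_ext T x d.+1.
  by rewrite poly_extS; apply: sub_shift_sum (submodule_poly_ext _ _ Tsub).
have VT t y : T t -> poly_ext T x d.+1 y -> poly_ext T x d.+1 (t * y).
  move=> Tt [s [Ts ->]]; exists (fun i => t * s i).
  split=> [i|]; first exact: TM.
  by rewrite mulr_sumr; apply: eq_bigr => i _; rewrite mulrA.
have Vx y : poly_ext T x d.+1 y -> poly_ext T x d.+1 (x * y).
  move=> [s [Ts ->]]; rewrite big_ord_recr /= mulrDr mulrCA -exprS.
  case: (Vsub) => _ VD _; apply: VD; last exact: VT.
  rewrite poly_extS; exists 0, (\sum_(i < d) s i * x ^+ i); split; last 1 first.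
  - by rewrite add0r.
  - by case: Tsub.
  - by exists s.
apply/intermediate_ringsE; split=> [y z|y z [s [Ts ->]] Vz|r].
- exact: (submoduleB Vsub).
- case: (Vsub) => V0 VD _.
  rewrite mulr_suml; apply: (big_ind (poly_ext T x d.+1)) => //.
  move=> i _; rewrite -mulrA; apply: VT => //.
  elim: (i : nat) => [|k IH]; first by rewrite mul1r.
  by rewrite exprS -mulrA; apply: Vx.
- exact/TV/Tf.
Qed.

Lemma chain_finite_poly_ext T x d : submodule f T -> PS `<=` T ->
  chain_finite (submods f PS T) ->
  chain_finite (submods f PS (poly_ext T x d.+1)).
Proof.
move=> Tsub PST Tfin.
have PSsub := submodule_prodspan f P setT.
have step B : submodule f B -> PS `<=` B -> chain_finite (submods f PS B) ->
    chain_finite (submods f PS (shift_sum T x B)).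
  move=> Bsub PSB Bfin; have TxBsub := submodule_shift_sum x Tsub Bsub.
  apply: (chain_finite_trans Tsub) => //; first exact: sub_shift_sum Bsub.
  apply: chain_finite_shift Bfin => // a PSa.
  exact: PST _ (prodspan_mul _ PSa).
elim: d => [|d IH].
  suff -> : poly_ext T x 1 = T by [].
  apply/seteqP; split=> [_ [t [Tt ->]]|a Ta]; first by rewrite big_ord1 mulr1.
  by exists (fun=> a); rewrite big_ord1 mulr1.
rewrite poly_extS; apply: step IH; first exact: submodule_poly_ext.
rewrite poly_extS; apply: subset_trans PST _.
exact: sub_shift_sum (submodule_poly_ext _ _ Tsub).
Qed.

(** The image of [R] in [S/PS] is a quotient of the residue field of [P], so it
    has no submodule other than zero and itself. *)
Lemma chain_finite_constants :
  chain_finite (submods f PS (shift_sum PS 1 (range f))).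
Proof.
have [_ _ Pinv] := Pmax; have PSsub := submodule_prodspan f P setT.
apply: (@chain_finite_sub _ _ [set PS; shift_sum PS 1 (range f)]); last first.
  by move=> C CP _; apply: sub_finite_set CP (finite_set2 _ _).
move=> N [[N0 ND NZ] PSN Nsub].
have [N1|nN1] := pselect (N 1); [right|left]; apply/seteqP; split=> // y.
  move=> [a [_ [PSa [r _ <-] ->]]]; apply: ND; first exact: PSN.
  by rewrite mulrC; apply: NZ.
move=> Ny; have [a [_ [PSa [r _ <-] yE]]] := Nsub y Ny.
case: (PSsub) => _ PSD _; rewrite yE; apply: PSD => //; rewrite mulrC.
apply: prodspan_gen => //; apply: contrapT => nPr; apply: nN1.
have [b Pb] := Pinv r nPr.
have -> : 1 = f (1 - b * r) * 1 + f b * (y - a) :> S.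
  by rewrite yE (addrC a) addrK mul1r rmorphB rmorph1 rmorphM mulr1 subrK.
apply: (ND); first by apply: (PSN); apply: prodspan_gen.
by apply: NZ; apply: ND => //; apply: PSN; apply: (submoduleN PSsub).
Qed.

Lemma constants_ring : intermediate_rings f (shift_sum PS 1 (range f)).
Proof.
have PSsub := submodule_prodspan f P setT; case: (PSsub) => PS0 PSD PSZ.
apply/intermediate_ringsE; split.
- move=> _ _ [a [_ [PSa [r _ <-] ->]]] [b [_ [PSb [s _ <-] ->]]].
  exists (a - b), (f (r - s)); split; last 1 first.
  + by rewrite !mul1r rmorphB opprD addrACA.
  + exact: (submoduleB PSsub).
  + by exists (r - s).
- move=> _ _ [a [_ [PSa [r _ <-] ->]]] [b [_ [PSb [s _ <-] ->]]].
  exists ((b + f s) * a + f r * b), (f (r * s)); split; last 1 first.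
  + by rewrite !mul1r rmorphM mulrDl (mulrC a) mulrDr addrA.
  + by apply: PSD; [exact: prodspan_mul|exact: PSZ].
  + by exists (r * s).
- by move=> r; exists 0, (f r); rewrite mul1r add0r.
Qed.

(** Among the subrings [T] with [T/PS] of finite length there is a maximal one,
    and it cannot be enlarged by any element of [S]. *)
Lemma chain_finite_residue : FCP f -> chain_finite (submods f PS setT).
Proof.
move=> fcp; have PSsub := submodule_prodspan f P setT.
have [||T /= [Tring PST Tfin] Tmax] := @minimal_element _
  [set T | [/\ intermediate_rings f T, PS `<=` T
             & chain_finite (submods f PS T)]]
  (fun T' T => T `<=` T' /\ ~ T' `<=` T).
- move=> u uP ult.
  have [k|k|k sub] := chain_finite_acc (u := u) fcp.
  + by case: (uP k).
  + by case: (ult k).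
  + by case: (ult k).
- exists (shift_sum PS 1 (range f)); split.
  + exact: constants_ring.
  + apply: sub_shift_sum; split=> [|_ _ [r _ <-] [s _ <-]|r _ [s _ <-]].
    * by exists 0; rewrite ?rmorph0.
    * by exists (r + s); rewrite ?rmorphD.
    * by exists (r * s); rewrite ?rmorphM.
  + exact: chain_finite_constants.
suff TT : T = setT by move: Tfin; rewrite TT.
apply/seteqP; split=> // x _; apply: contrapT => nTx.
have Tsub := intermediate_submodule Tring.
have /intermediate_ringsE[_ _ Tf] := Tring.
have [p [M [px0 pM]]] := FCP_relation x fcp.
have [||d [b]] := @integral_mod_max x (size p) (fun i => p`_i).
- move: px0; rewrite (horner_coef_wide _ (size_poly _ _)) => px0.
  have -> : \sum_(i < size p) f p`_i * x ^+ i = 0.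
    by rewrite -[RHS]px0; apply: eq_bigr => i _; rewrite coef_map.
  by case: PSsub.
- exists M; last by rewrite pM; case: Pmax.
  by rewrite ltnNge; apply/negP => /(nth_default 0) /eqP; rewrite pM oner_eq0.
(* A relation of degree 0 says that 1 lies in PS, so PS is everything. *)
case: d => [|d] PSx.
  apply: nTx; apply: PST; rewrite -[x]mulr1; apply: prodspan_mul.
  by move: PSx; rewrite big_ord0 subr0.
have TV : T `<=` poly_ext T x d.+1.
  by rewrite poly_extS; apply: sub_shift_sum (submodule_poly_ext _ _ Tsub).
have Vring : intermediate_rings f (poly_ext T x d.+1).
  apply: poly_ext_ring => //.
  rewrite -[X in poly_ext _ _ _ X](subrK (\sum_(i < d.+1) f (b i) * x ^+ i)).
  have [_ VD _] := submodule_poly_ext x d.+1 Tsub.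
  by apply: VD; [by apply: TV; apply: PST|exists (fun i => f (b i))].
apply: (Tmax (poly_ext T x d.+1)).
  split=> //; first exact: subset_trans TV.
  exact: chain_finite_poly_ext.
split=> // VT.
apply/nTx/VT; case: d => [|d] in PSx VT Vring TV *; last first.
  exists (fun i => (i == 1%N)%:R); split=> [i|]; last first.
    rewrite !big_ord_recl big1 /= => [|i _]; last by rewrite mul0r.
    by rewrite mul0r mul1r add0r addr0.
  by case: eqP => _; rewrite ?mulr0n ?mulr1n -?(rmorph0 f) -?(rmorph1 f).
(* A relation of degree 1 makes x congruent to a constant modulo PS. *)
apply: TV; move: PSx; rewrite big_ord1 !expr0 expr1 mulr1 => /PST Txb.
by rewrite -[x](subrK (f (b 0%N))); case: Tsub => _ TD _; apply: TD.
Qed.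

End Residue.

(** * Finite length *)

(** Induction along [artinian_ind] on the finite length of [S/JS]. *)
Lemma finite_length (R S : comNzRingType) (f : {rmorphism R -> S}) :
  artinian R -> FCP f -> chain_finite (submodule f).
Proof.
move=> Rart fcp; pose JS J := prodspan f J setT.
suff fin0 : chain_finite (submods f (JS [set 0]) setT).
  apply: chain_finite_sub fin0 => N Nsub; split=> // y; apply=> // a s -> _.
  by rewrite rmorph0 mul0r; case: Nsub.
apply: (artinian_ind Rart (Q := fun J => chain_finite (submods f (JS J) setT))).
  suff JSE : JS setT = setT.
    rewrite JSE; apply: (@chain_finite_sub _ _ [set setT]).
      by move=> N [_ TN _]; apply/seteqP; split.
    by move=> C CP _; apply: sub_finite_set CP (finite_set1 _).
  apply/seteqP; split=> // s _; rewrite -[s]mul1r -(rmorph1 f).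
  exact: prodspan_gen.
move=> P I y Pmax Iid PyI; set J := shift_sum I y setT => Jfin.
have ISsub := submodule_prodspan f I setT.
have JSsub := submodule_prodspan f J setT.
have IJ : I `<=` J by apply: (@sub_shift_sum _ _ idfun).
have JSE : JS J = shift_sum (JS I) (f y) setT.
  apply/seteqP; split=> [z|_ [a [s [ISa _ ->]]]].
    apply; first exact: submodule_shift_sum.
    move=> _ s [a [b [Ia _ ->]]] _; exists (f a * s), (f b * s).
    split=> //; first exact: prodspan_gen.
    by rewrite rmorphD rmorphM mulrDl mulrA.
  case: (JSsub) => _ JSD _; apply: JSD.
    by apply: (ISa _ JSsub) => c t Ic _; apply: prodspan_gen => //; apply: IJ.
  by apply: prodspan_gen => //; exists 0, 1; rewrite mulr1 add0r; case: Iid.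
apply: (chain_finite_trans (B := JS J)) Jfin => //.
  by move=> z ISz; rewrite JSE; apply: sub_shift_sum (submoduleT f) _ ISz.
rewrite JSE; apply: chain_finite_shift (chain_finite_residue Pmax fcp) => //.
move=> a PSa; apply: (PSa [set t | JS I (f y * t)]) => [|p s Pp _].
  exact: submodule_preim.
rewrite /= mulrA -rmorphM.
by apply: prodspan_gen => //; rewrite mulrC; apply: PyI.
Qed.

(** * Products *)

(** Induction along the submodules [A k] of the tuples supported on the first [k]
    coordinates; the quotient of [A k.+1] by [A k] is the factor of index
    [k]. *)
Lemma finite_length_prod (R : comPzRingType) (n : nat)
    (R_ : 'I_n -> comPzRingType) (f : forall i, {rmorphism R -> R_ i}) :
  (forall i, chain_finite (submodule (f i))) ->
  chain_finite (submodule (diag_morph f)).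
Proof.
move=> ffin.
pose A k := [set x : {dffun forall i : 'I_n, R_ i} |
              forall i : 'I_n, (k <= i)%N -> x i = 0].
suff Afin k : (k <= n)%N ->
    chain_finite [set N | submodule (diag_morph f) N /\ N `<=` A k].
  apply: chain_finite_sub (Afin n (leqnn n)) => N Nsub; split=> // x _ i.
  by rewrite leqNgt ltn_ord.
elim: k => [_|k IH ltkn].
  apply: (@chain_finite_sub _ _ [set [set 0]]); last first.
    by move=> C CP _; apply: sub_finite_set CP (finite_set1 _).
  move=> N [[N0 _ _] NA]; apply/seteqP; split=> [x Nx|_ -> //].
  by apply/ffunP => i; rewrite ffunE (NA x Nx).
pose k' := Ordinal ltkn.
apply: (chain_finite_embed (phi1 := setI (A k))
  (phi2 := fun N => (fun x : {dffun forall i : 'I_n, R_ i} => x k') @` N)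
  _ _ _ _ _ (IH (ltnW ltkn)) (ffin k')).
- move=> N [[N0 ND NZ] _]; split; last by move=> x [].
  split=> [|x y [Ax Nx] [Ay Ny]|r x [Ax Nx]].
  + by split=> // i _; rewrite ffunE.
  + by split=> [i ki|]; [rewrite ffunE Ax // Ay // addr0|exact: ND].
  + by split=> [i ki|]; [rewrite !ffunE Ax // mulr0|exact: NZ].
- move=> N [[N0 ND NZ] _]; split=> [|_ _ [x Nx <-] [y Ny <-]|r _ [x Nx <-]].
  + by exists 0; rewrite ?ffunE.
  + by exists (x + y); rewrite ?ffunE //; apply: ND.
  + by exists (diag_morph f r * x); rewrite ?ffunE //; apply: NZ.
- by move=> N N' NN' x [Ax Nx]; split=> //; apply: NN'.
- by move=> N N' NN' _ [x Nx <-]; exists x => //; apply: NN'.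
- move=> N N' [Nsub _] [N'sub N'A] NN' capNN' projNN' x N'x.
  have [|y Ny yx] := projNN' (x k'); first by exists x.
  rewrite -(subrK y x); case: (Nsub) => _ ND _; apply: ND => //.
  suff [] : (A k `&` N) (x - y) by [].
  apply: capNN'; split; last exact: (submoduleB N'sub N'x (NN' y Ny)).
  move=> i; rewrite leq_eqVlt => /predU1P[ki|ki]; rewrite !ffunE.
    by have -> : i = k' by [apply: val_inj]; rewrite yx subrr.
  by rewrite (N'A x N'x i ki) (N'A y (NN' y Ny) i ki) subrr.
Qed.

Lemma FCP_factor (R : comPzRingType) (n : nat)
    (R_ : 'I_n -> comPzRingType) (f : forall i, {rmorphism R -> R_ i}) i :
  FCP (diag_morph f) -> FCP (f i).
Proof.
apply: (chain_finite_embed1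
  (phi := fun T => [set x : {dffun forall i : 'I_n, R_ i} | T (x i)])).
- move=> T /intermediate_ringsE[TB TM Tf].
  apply/intermediate_ringsE; split=> /=.
  + by move=> x y Tx Ty; rewrite !ffunE; apply: TB.
  + by move=> x y Tx Ty; rewrite !ffunE; apply: TM.
  + by move=> r; rewrite ffunE.
- by move=> T T' TT' x; apply: TT'.
- move=> T T' _ _ _ sub y T'y.
  pose x : {dffun forall i : 'I_n, R_ i} := 
    [ffun j => dfwith (fun k => 0 : R_ k) y j].
  by have := sub x; rewrite /x /= ffunE dfwith_in; apply.
Qed.

(** The intermediate ring attached to an ideal [J] consists of the tuples with an
    entry [f i r] at [i] and a common entry congruent to [r] modulo [J]
    elsewhere.  Its tuples with entry 0 at [i] give [J] back in coordinate
    [j]. *)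
Lemma FCP_diag_artinian (R : comPzRingType) (n : nat)
    (R_ : 'I_n -> comPzRingType) (f : forall i, {rmorphism R -> R_ i}) i j :
  i != j -> injective (f i) -> injective (f j) ->
  FCP (diag_morph f) -> artinian R.
Proof.
move=> ij fi_inj fj_inj fcp I Iid Idec.
suff : chain_finite (@is_ideal R) by move/chain_finite_dcc; apply.
apply: (chain_finite_embed1 (phi := fun J =>
  [set x : {dffun forall k : 'I_n, R_ k} | exists r a, J a /\
     forall k, x k = f k (if k == i then r else r + a)]) _ _ _ fcp).
- move=> J /is_idealE Jid; have [J0 JD JZ] := Jid.
  apply/intermediate_ringsE; split=> /=.
  + move=> x y [r [a [Ja xE]]] [s [b [Jb yE]]]; exists (r - s), (a - b).
    split=> [|k]; first exact: (submoduleB Jid).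
    by rewrite !ffunE xE yE; case: eqP => _; rewrite -rmorphB // opprD addrACA.
  + move=> x y [r [a [Ja xE]]] [s [b [Jb yE]]].
    exists (r * s), ((s + b) * a + r * b); split=> [|k].
      by apply: (JD); apply: (JZ).
    rewrite !ffunE xE yE; case: eqP => _; rewrite -rmorphM //.
    by rewrite mulrDl mulrDr (mulrC a) -addrA (addrC (_ * a)).
  + move=> r; exists r, 0; split=> // k.
    by rewrite ffunE addr0; case: eqP.
- by move=> J J' JJ' x [r [a [Ja xE]]]; exists r, a; split=> //; apply: JJ'.
- move=> J J' _ _ _ sub a J'a.
  pose x : {dffun forall k : 'I_n, R_ k} :=
    [ffun k => f k (if k == i then 0 else a)].
  have [|r [b [Jb xE]]] := sub x.
    by exists 0, a; split=> // k; rewrite ffunE add0r.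
  have r0 : r = 0.
    by apply/esym/fi_inj; have := xE i; rewrite ffunE eqxx.
  suff -> : a = b by [].
  by apply: fj_inj; have := xE j; rewrite ffunE eq_sym (negPf ij) r0 add0r.
Qed.

Theorem theorem2p11 (n : nat) (hn : (2 <= n)%N) (R : comNzRingType)
    (R_ : 'I_n -> comNzRingType) (f : forall i : 'I_n, {rmorphism R -> R_ i})
    (f_inj : forall i : 'I_n, injective (f i)) :
  FCP (diag_morph f) <-> artinian R /\ (forall i : 'I_n, FCP (f i)).
Proof.
split=> [fcp|[Rart ffcp]].
  split=> [|i]; last exact: FCP_factor fcp.
  pose i0 := Ordinal (ltnW hn); pose i1 := Ordinal hn.
  apply: (FCP_diag_artinian (i := i0) (j := i1) _ _ _ fcp) => //.
    exact: f_inj.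
  exact: f_inj.
apply: (chain_finite_sub (Q := submodule (diag_morph f))).
  exact: intermediate_submodule.
apply: finite_length_prod => i.
exact: finite_length.
Qed.
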